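(* Let $\mathsf C(t)$, $t\ge0$, denote the solution of $\dot{\mathsf C}(t) = -\alpha\,\mathsf C(t)A^T\Gamma^{-1}A\,\mathsf C(t)$ with initial condition $\mathsf C(0)=\mathsf C_0$, and let $\mathsf C_\infty=\lim_{t\to\infty}\mathsf C(t)$. Then the limit $$\hat{\mathsf C}:=\lim_{t\to\infty}t\,(\mathsf C(t)-\mathsf C_\infty)$$ exists and satisfies $\mathcal A(\hat{\mathsf C})=\hat{\mathsf C}$, where $\mathcal A:\mathbb R^{n\times n}\to\mathbb R^{n\times n}$ is the nonlinear operator $\mathcal A(M)=\alpha\,M A^T\Gamma^{-1}A\,M$.
   Context: $A\in\mathbb R^{m\times n}$; $\Gamma\in\mathbb R^{m\times m}$ is symmetric positive definite; $\mathsf C_0\in\mathbb R^{n\times n}$ is symmetric positive definite; $\alpha>0$. The solution is explicitly $\mathsf C(t)=\mathsf C_0(E+\alpha tA^T\Gamma^{-1}A\,\mathsf C_0)^{-1}$, with $E$ the $n\times n$ identity matrix, and the limit $\mathsf C_\infty$ exists. *)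

(* Defs.v *)
From HB Require Import structures.
From mathcomp Require Import all_boot all_order all_algebra.
From mathcomp Require Import all_classical all_reals all_analysis.

Set Implicit Arguments.
Unset Strict Implicit.
Unset Printing Implicit Defensive.

Import Order.TTheory GRing.Theory Num.Theory.
Import numFieldNormedType.Exports.

Local Open Scope classical_set_scope.
Local Open Scope ring_scope.

Definition posdefmx (R : realType) (k : nat) (M : 'M[R]_k) : Prop :=
  M \is symmetricmx /\
  forall v : 'cV[R]_k, v != 0 -> 0 < (v^T *m M *m v) 0 0.

Definition riccati_op (R : realType) (m n : nat) (alpha : R)
    (A : 'M[R]_(m, n)) (Gamma : 'M[R]_m) (M : 'M[R]_n) : 'M[R]_n :=
  alpha *: (M *m A^T *m invmx Gamma *m A *m M).

(* The derivative is taken relative to [0, +oo[: two-sided for t > 0 and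
   one-sided at t = 0.  Values of C at negative times play no role. *)
Definition riccati_solution (R : realType) (m n : nat) (alpha : R)
    (A : 'M[R]_(m, n)) (Gamma : 'M[R]_m) (C0 : 'M[R]_n) (C : R -> 'M[R]_n) :
    Prop :=
  C 0 = C0 /\
  forall t : R, 0 <= t ->
    (s - t)^-1 *: (C s - C t) @[s --> within [set s | 0 <= s] t^']
      --> - riccati_op alpha A Gamma (C t).

(* Main.v *)
(* Put S = A^T Gamma^-1 A and N = S C0.  The matrix D(t) = C(t)(1 + alpha t N) - C0
   solves the linear equation D' = -alpha C S D with D(0) = 0, so D = 0.
   Since S is symmetric and C0 positive definite, N and N^2 have the same rank,
   hence N = N^2 G = Y N^2 for some G and Y.  With Cinf = C0 (1 - N G), the identity
   D = 0 gives alpha t (C(t) - Cinf) = (C0 - C(t)) G.  This bounds C(t), hence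
   forces C(t) --> Cinf, and then t (C(t) - Cinf) --> alpha^-1 (C0 - Cinf) G. *)

Require Import Defs.
From HB Require Import structures.
From mathcomp Require Import all_boot all_order all_algebra.
From mathcomp Require Import all_classical all_reals all_analysis.
From mathcomp Require Import ring lra.
Import Order.TTheory GRing.Theory Num.Theory.
Import numFieldNormedType.Exports.
Local Open Scope classical_set_scope.
Local Open Scope ring_scope.

(** * Max norm of matrices and entrywise convergence *)

Lemma ler_mx_entry (R : realDomainType) (m n : nat) (M : 'M[R]_(m, n)) i j :
  `|M i j| <= `|M|.
Proof.
by rewrite [leRHS]/Num.Def.normr /= mx_normrE; exact: (le_bigmax _ _ (i, j)).
Qed.

Lemma mx_norm_le (R : realDomainType) (m n : nat) (M : 'M[R]_(m, n)) e :
  0 <= e -> (forall i j, `|M i j| <= e) -> `|M| <= e.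
Proof.
move=> e0 Me; rewrite [leLHS]/Num.Def.normr /= mx_normrE.
by apply: bigmax_le => // -[i j] _; exact: Me.
Qed.

Lemma ler_norm_mulmx (R : realDomainType) (m n p : nat)
    (M : 'M[R]_(m, n)) (N : 'M[R]_(n, p)) : `|M *m N| <= n%:R * `|M| * `|N|.
Proof.
apply: mx_norm_le => [|i j]; first by rewrite !mulr_ge0.
rewrite mxE (le_trans (ler_norm_sum _ _ _))//.
apply: (@le_trans _ _ (\sum_(k < n) `|M| * `|N|)); last first.
  by rewrite sumr_const card_ord -mulrA mulr_natl.
by apply: ler_sum => k _; rewrite normrM ler_pM// ler_mx_entry.
Qed.

Lemma cvg_mxP (R : realType) (T : Type) (F : set_system T) {FF : Filter F}
    (m n : nat) (f : T -> 'M[R]_(m, n)) (M : 'M[R]_(m, n)) :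
  f x @[x --> F] --> M <-> forall i j, f x i j @[x --> F] --> M i j.
Proof.
split=> [fM i j|fM].
  exact: cvg_comp fM (@coord_continuous _ _ _ i j M).
apply/cvgrPdist_le => e e0; near=> x; apply: mx_norm_le => [|i j]; first exact: ltW.
rewrite !mxE; move: i j; near: x.
apply: filter_forall => i; apply: filter_forall => j.
by have /cvgrPdist_le := fM i j; apply.
Unshelve. all: by end_near. Qed.

Lemma cvg_mulmx (R : realType) (T : Type) (F : set_system T) {FF : Filter F}
    (m n p : nat) (f : T -> 'M[R]_(m, n)) (g : T -> 'M[R]_(n, p))
    (M : 'M[R]_(m, n)) (N : 'M[R]_(n, p)) :
  f x @[x --> F] --> M -> g x @[x --> F] --> N ->
  f x *m g x @[x --> F] --> M *m N.
Proof.
move=> /cvg_mxP fM /cvg_mxP gN; apply/cvg_mxP => i j.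
under eq_fun do rewrite mxE; rewrite mxE.
by apply: cvg_big => [|k _]; [exact: add_continuous|apply: cvgM].
Qed.

(** * Difference quotients, continuity and derivatives *)

(** Write f(s) as (s - t) times the slope plus f(t); the first term tends to 0. The slope is
    controlled only for s different from t, so the point s = t is treated apart. *)
Lemma cvg_within_slope (R : realType) (V : normedModType R) (D : set R)
    (f : R -> V) (t : R) (l : V) :
  (s - t)^-1 *: (f s - f t) @[s --> within D t^'] --> l ->
  f s @[s --> within D (nbhs t)] --> f t.
Proof.
move=> fl.
have st0 : (s - t : R) @[s --> within D t^'] --> (0 : R).
  have st : (s - t : R) @[s --> t] --> (t - t).
    by apply: cvgB; [exact: cvg_id|exact: cvg_cst].
  by rewrite subrr in st; apply: cvg_within_filter; exact: cvg_within_filter.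
have /cvgrPdist_le ft : (s - t) *: ((s - t)^-1 *: (f s - f t)) + f t
    @[s --> within D t^'] --> f t.
  rewrite -[X in _ --> X]add0r -(scale0r l).
  by apply: cvgD; [apply: cvgZ|exact: cvg_cst].
apply/cvgrPdist_le => e e0.
have := ft e e0; rewrite !near_withinE.
apply: filterS => s + Ds; have [->|st] := eqVneq s t.
  by move=> _; rewrite subrr normr0 ltW.
by move=> /(_ isT Ds); rewrite scalerA mulfV ?subr_eq0// scale1r subrK.
Qed.

Lemma is_derive_slope (R : realType) (V : normedModType R) (f : R -> V) (t : R)
    (l : V) :
  (s - t)^-1 *: (f s - f t) @[s --> t^'] --> l -> is_derive t 1 f l.
Proof.
move=> fl.
suff H : h^-1 *: ((f \o shift t) (h *: (1 : R)) - f t) @[h --> 0^'] --> l.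
  by split; [exact: cvgP H|exact: cvg_lim H].
apply/cvgrPdist_le => e e0; have /cvgrPdist_le/(_ e e0) := fl.
rewrite !near_withinE => -[d /= d0 H]; exists d => //= h; rewrite /= sub0r normrN => hd h0.
have := H (h + t); rewrite /= opprD addrCA subrr addr0 normrN.
move=> /(_ hd); rewrite addrK /= /shift /= /GRing.scale /= mulr1; apply.
by rewrite -subr_eq0 addrK.
Qed.

(** * Rank of a square and factorization through it *)

(** It suffices that the row space of P S meets its left kernel trivially. If w = v P S and w P S =
    0, then w P w^T = (w P S) P^T v^T = 0, so w = 0 by positivity. *)
Lemma posdefmx_rank_sq (R : realType) (n : nat) (S P : 'M[R]_n) :
  S^T = S -> posdefmx P -> \rank (P *m S *m (P *m S)) = \rank (P *m S).
Proof.
move=> SS [_ Ppos].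
have := mxrank_mul_ker (P *m S) (P *m S).
suff -> : (P *m S :&: kermx (P *m S))%MS = 0 by rewrite mxrank0 addn0.
apply/eqP/rowV0P => u; rewrite sub_capmx => /andP[/submxP[v ->]] /sub_kermxP uPS.
apply/eqP/negPn/negP => w0.
have := Ppos (v *m (P *m S))^T; rewrite trmx_eq0 => /(_ w0).
rewrite trmxK trmx_mul [(P *m S)^T]trmx_mul SS.
by rewrite !mulmxA in uPS *; rewrite uPS !mul0mx mxE ltxx.
Qed.

(** The row space of N^2 always lies in that of N; equal ranks make the two coincide. *)
Lemma rank_sq_factor (F : fieldType) (n : nat) (N : 'M[F]_n) :
  \rank (N *m N) = \rank N -> exists Y, N = Y *m N *m N.
Proof.
move=> rN; have /submxP[Y NY] : (N <= N *m N)%MS.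
  by rewrite -(eq_leqif (mxrank_leqif_sup (submxMl N N))) rN.
by exists Y; rewrite -mulmxA.
Qed.

(** * Uniqueness for linear differential equations *)

(** The integrating factor exp(-c t) turns [phi] into a function [g] with nonpositive derivative, so
    [g] stays below its initial value 0. *)
Lemma gronwall_le0 (R : realType) (phi dphi : R -> R) (c T : R) :
  0 <= T -> {within `[0, T], continuous phi} ->
  (forall t, 0 < t < T -> is_derive t 1 phi (dphi t)) ->
  (forall t, 0 < t < T -> dphi t <= c * phi t) ->
  phi 0 = 0 -> phi T <= 0.
Proof.
move=> T0 cphi dphiP dphi_le phi0.
pose g : R -> R := (expR \o (- c \*: id)) * phi.
have dg t : 0 < t < T ->
    is_derive t 1 g (expR (- c * t) * dphi t - c * expR (- c * t) * phi t).
  move=> t0T; have ? := dphiP t t0T.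
  by apply: is_derive_eq; rewrite /= /GRing.scale /=; ring.
have cg : {within `[0, T], continuous g}.
  move=> t; apply: cvgM; last exact: cphi.
  apply: continuous_subspaceT => s; apply: continuous_comp; last exact: continuous_expR.
  by apply: cvgZr; exact: cvg_id.
have : g T <= g 0.
  apply: (@ler0_derive1_le_cc _ g 0 T) => //; rewrite ?in_itv/= ?lexx ?T0//.
  - by move=> x /[!in_itv]/= /dg [].
  - move=> x /[!in_itv]/= xT; rewrite derive1E; have /@derive_val -> := dg x xT.
    rewrite -mulrA mulrCA -mulrBr pmulr_rle0 ?expR_gt0// subr_le0.
    exact: dphi_le.
by rewrite /g !mulrfctE phi0 mulr0 pmulr_rle0// expR_gt0.
Qed.

Lemma continuous_mx_bounded (R : realType) (m n : nat) (T : R)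
    (B : R -> 'M[R]_(m, n)) :
  {within `[0, T], continuous B} ->
  exists2 K, 0 < K & forall t, 0 <= t <= T -> `|B t| <= K.
Proof.
move=> cB.
have /ex_strict_bound_gt0[K K0 BK] : bounded_set (B @` `[0, T]).
  exact/compact_bounded/continuous_compact/segment_compact.
exists K => // t tT; apply/ltW/BK; exists t => //.
Qed.

Lemma linear_ode_eq0 (R : realType) (n p : nat) (B : R -> 'M[R]_n)
    (D : R -> 'M[R]_(n, p)) :
  (forall t : R, 0 <= t -> B s @[s --> within [set s | 0 <= s] (nbhs t)] --> B t) ->
  (forall t : R, 0 <= t -> (s - t)^-1 *: (D s - D t)
    @[s --> within [set s | 0 <= s] t^'] --> B t *m D t) ->
  D 0 = 0 -> forall T, 0 <= T -> D T = 0.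
Proof.
move=> cB dD D0 T T0.
have within0T (m q : nat) (f : R -> 'M[R]_(m, q)) :
    (forall t : R, 0 <= t -> f s @[s --> within [set s | 0 <= s] (nbhs t)] --> f t) ->
    {within `[0, T], continuous f}.
  move=> cf; apply/subspace_continuousP => t /=.
  rewrite in_itv/= => /andP[t0 _]; apply: cvg_trans (cf t t0).
  apply: cvg_fmap2; apply: within_subset => s /=.
  by rewrite in_itv/= => /andP[].
have cD : {within `[0, T], continuous D}.
  by apply: within0T => t t0; exact: cvg_within_slope (dD t t0).
have [K K0 BK] := continuous_mx_bounded _ _ _ _ _ (within0T _ _ _ cB).
(* The energy |D|^2 satisfies a differential inequality phi' <= c phi. *)
pose phi : R -> R := \sum_(i < n) \sum_(j < p) (fun t => D t i j) ^+ 2.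
have phiE t : phi t = \sum_(i < n) \sum_(j < p) D t i j ^+ 2.
  by rewrite /phi fct_sumE; apply: eq_bigr => i _; rewrite fct_sumE.
have phi_ge t i j : D t i j ^+ 2 <= phi t.
  rewrite phiE (bigD1 i)//= (bigD1 j)//= -addrA lerDl.
  rewrite addr_ge0// ?sumr_ge0// => k _; first exact: sqr_ge0.
  by rewrite sumr_ge0// => l _; exact: sqr_ge0.
have normD_le t : `|D t| ^+ 2 <= phi t.
  have phi0 : 0 <= phi t.
    by rewrite phiE !sumr_ge0// => *; rewrite sumr_ge0// => *; exact: sqr_ge0.
  rewrite -[leRHS]sqr_sqrtr// ler_pXn2r ?nnegrE ?sqrtr_ge0//.
  apply: mx_norm_le => [|i j]; first exact: sqrtr_ge0.
  by rewrite -sqrtr_sqr ler_wsqrtr.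
pose dphi t := \sum_(i < n) \sum_(j < p) 2 * D t i j * (B t *m D t) i j.
have phi'E t : 0 < t < T -> is_derive t 1 phi (dphi t).
  move=> /andP[t0 _]; apply: is_derive_sum => i; apply: is_derive_sum => j.
  have ? : is_derive t 1 (fun t => D t i j) ((B t *m D t) i j).
    apply: is_derive_slope.
    (* Near t > 0 every s is nonnegative, so the restricted limit becomes a two-sided one. *)
    have /cvg_mxP/(_ i j) : (s - t)^-1 *: (D s - D t) @[s --> t^'] --> B t *m D t.
      apply: cvg_trans (dD t (ltW t0)); apply: cvg_fmap2.
      move=> P; have /nbhs_dnbhs : \forall s \near t, 0 <= s.
        exact: cvgr_ge (fun P Pt => Pt) _ t0.
      by apply: filterS2 => s s0; apply.
    by under eq_fun do rewrite !mxE.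
  apply: is_derive_eq.
  by rewrite /GRing.scale /= expr1.
(* Each of the n p summands is at most 2 |D| (n K |D|), where n comes from bounding a matrix product
   in the max norm, and |D|^2 is at most [phi]. *)
have dphi_le t : 0 < t < T ->
    dphi t <= (n%:R * p%:R * (2 * (n%:R * K))) * phi t.
  move=> /andP[t0 tT].
  apply: (@le_trans _ _ (\sum_(i < n) \sum_(j < p) 2 * (n%:R * K) * phi t)).
    apply: ler_sum => i _; apply: ler_sum => j _.
    rewrite -!mulrA ler_pM2l// (le_trans (ler_norm _))// normrM.
    apply: (@le_trans _ _ (`|D t| * (n%:R * K * `|D t|))).
      rewrite ler_pM ?ler_mx_entry// (le_trans (ler_mx_entry _ _ _ _ _ _))//.
      rewrite (le_trans (ler_norm_mulmx _ _ _ _ _ _))// ler_wpM2r// ler_wpM2l//.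
      by rewrite BK// !ltW.
    rewrite [leRHS]mulrA [leLHS](_ : _ = n%:R * K * `|D t| ^+ 2); last by ring.
    by rewrite ler_wpM2l// mulr_ge0// ltW.
  rewrite !sumr_const !card_ord -[X in X *+ n]mulr_natl -[X in X <= _]mulr_natl.
  by rewrite !mulrA.
have cphi : {within `[0, T], continuous phi}.
  apply/subspace_continuousP => t tT.
  rewrite (funext phiE : phi = fun t => \sum_(i < n) \sum_(j < p) D t i j ^+ 2).
  apply: cvg_big => [|i _]; first exact: add_continuous.
  apply: cvg_big => [|j _]; first exact: add_continuous.
  have /subspace_continuousP/(_ t tT)/cvg_mxP/(_ i j) Dij := cD.
  by apply: cvgM.
have phi0 : phi 0 = 0.
  by rewrite phiE big1// => i _; rewrite big1// => j _; rewrite D0 mxE expr0n.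
have := gronwall_le0 _ _ _ _ _ T0 cphi phi'E dphi_le phi0.
move=> /(le_trans (normD_le T)) DT0.
by apply/eqP; rewrite -normr_eq0 -sqrf_eq0 eq_le DT0 sqr_ge0.
Qed.

(** * The resolvent identity for the Riccati solution *)

(** With X = 1 + alpha t N, the product rule gives (C X)' = -alpha C S C X + alpha C S C0 = -alpha C
    S (C X - C0). Reading the factor -alpha C S as a given continuous coefficient makes this linear
    in C X - C0. *)
Lemma riccati_resolvent (R : realType) (m n : nat) (alpha : R)
    (A : 'M[R]_(m, n)) (Gamma : 'M[R]_m) (C0 : 'M[R]_n) (C : R -> 'M[R]_n) :
  riccati_solution alpha A Gamma C0 C -> forall t, 0 <= t ->
  C t *m (1%:M + (alpha * t) *: (A^T *m invmx Gamma *m A *m C0)) = C0.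
Proof.
move=> [CC0 dC]; set S := A^T *m invmx Gamma *m A; set N := S *m C0.
pose X t : 'M[R]_n := 1%:M + (alpha * t) *: N.
have XB s t : X s - X t = (s - t) *: (alpha *: N).
  by rewrite /X opprD addrACA subrr add0r -scalerBl scalerA -mulrBr mulrC.
have dCE M : riccati_op alpha A Gamma M = alpha *: (M *m S *m M).
  by rewrite /riccati_op /S !mulmxA.
have cC (t : R) : 0 <= t -> C s @[s --> within [set s | 0 <= s] (nbhs t)] --> C t.
  by move=> t0; exact: cvg_within_slope (dC t t0).
suff D0 t : 0 <= t -> C t *m X t - C0 = 0.
  by move=> t t0; apply/eqP; rewrite -subr_eq0; apply/eqP; exact: D0.
apply: (@linear_ode_eq0 R n n (fun t => - alpha *: (C t *m S))
  (fun t => C t *m X t - C0)) => {t}.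
- move=> t t0; apply: cvgZr; apply: cvg_mulmx; [exact: cC|exact: cvg_cst].
- move=> t t0.
  have cX : X s @[s --> within [set s | 0 <= s] t^'] --> X t.
    have cX : X s @[s --> t] --> X t.
      apply: cvgD; first exact: cvg_cst.
      by apply: cvgZl; apply: cvgZr; exact: cvg_id.
    by do 2 apply: cvg_within_filter.
  (* Discrete product rule: X is taken at s and C at t, and the slope of X is the constant alpha
     N. *)
  have H : ((s - t)^-1 *: (C s - C t)) *m X s + C t *m (alpha *: N)
      @[s --> within [set s | 0 <= s] t^']
      --> (- riccati_op alpha A Gamma (C t)) *m X t + C t *m (alpha *: N).
    apply: cvgD; last exact: cvg_cst.
    by apply: cvg_mulmx; first exact: dC.
  have -> : - alpha *: (C t *m S) *m (C t *m X t - C0) =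
      (- riccati_op alpha A Gamma (C t)) *m X t + C t *m (alpha *: N).
    rewrite dCE scaleNr !mulNmx mulmxBr opprB addrC.
    by rewrite -!scalemxAl -scalemxAr /N !mulmxA.
  move: H; apply: cvg_trans; apply: near_eq_cvg.
  have : \forall s \near within [set s | 0 <= s] t^', s != t.
    by have := nbhs_dnbhs_neq t; exact: cvg_within.
  apply: filterS => s st.
  rewrite opprB addrA subrK -scalemxAl -[alpha *: N]scale1r.
  have -> : 1 = (s - t)^-1 * (s - t) by rewrite mulVf// subr_eq0.
  rewrite -scalerA -XB -scalemxAr -scalerDr mulmxBl mulmxBr.
  by rewrite addrA subrK.
- by rewrite CC0 /X mulr0 scale0r addr0 mulmx1 subrr.
Qed.

(** * Long-time asymptotics *)

Theorem theorem2p2 (R : realType) (m n : nat) (alpha : R)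
    (A : 'M[R]_(m, n)) (Gamma : 'M[R]_m) (C0 : 'M[R]_n) (C : R -> 'M[R]_n)
    (alpha_gt0 : 0 < alpha) (Gamma_posdef : posdefmx Gamma)
    (C0_posdef : posdefmx C0)
    (C_sol : riccati_solution alpha A Gamma C0 C) :
  cvg (C t @[t --> +oo]) /\
  exists Chat : 'M[R]_n,
    t *: (C t - lim (C s @[s --> +oo])) @[t --> +oo] --> Chat /\
    riccati_op alpha A Gamma Chat = Chat.
Proof.
have CX := riccati_resolvent _ _ _ _ _ _ _ _ C_sol.
set S := A^T *m invmx Gamma *m A in CX; set N := S *m C0 in CX.
have trposdef k (P : 'M[R]_k) : posdefmx P -> P^T = P.
  by case=> /is_hermitianmxP; rewrite expr0 scale1r map_mx_id.
have ST : S^T = S.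
  by rewrite /S !trmx_mul trmxK trmx_inv trposdef// mulmxA.
have NT : N^T = C0 *m S by rewrite trmx_mul ST trposdef.
(* The rank lemma treats products of the form C0 S, which is N^T, so the claim is transposed. *)
have rN : \rank (N *m N) = \rank N.
  rewrite -mxrank_tr -[RHS]mxrank_tr trmx_mul NT.
  exact: posdefmx_rank_sq.
have NE : N = S *m C0 by [].
clearbody N.
have [Y NY] := rank_sq_factor _ _ _ rN.
have [G NG] : exists G, N = N *m N *m G.
  have [|Y' NY'] := rank_sq_factor _ _ N^T.
    by rewrite -trmx_mul !mxrank_tr.
  by exists Y'^T; rewrite -[LHS]trmxK {1}NY' !trmx_mul !trmxK mulmxA.
(* Both sides equal Y N^2 G. *)
have YN : N *m G = Y *m N by rewrite {1}NY -!mulmxA [N *m (N *m G)]mulmxA -NG.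
pose Cinf := C0 *m (1%:M - N *m G).
(* N (1 - N G) = 0, so 1 + alpha t N fixes 1 - N G, and C0 can be replaced by C(t). *)
have CinfE t : 0 <= t -> Cinf = C t *m (1%:M - N *m G).
  move=> t0; rewrite /Cinf -{1}(CX t t0) -mulmxA; congr (_ *m _).
  rewrite mulmxDl mul1mx -scalemxAl mulmxBr mulmx1 [N *m (N *m G)]mulmxA -NG.
  by rewrite subrr scaler0 addr0.
(* Both sides equal alpha t C(t) N G. *)
have subC t : 0 <= t -> (alpha * t) *: (C t - Cinf) = (C0 - C t) *m G.
  move=> t0; have -> : C0 - C t = (alpha * t) *: (C t *m N).
    by rewrite -{1}(CX t t0) mulmxDr mulmx1 addrC addKr scalemxAr.
  have -> : C t - Cinf = C t *m (N *m G).
    by rewrite (CinfE t t0) mulmxBr mulmx1 opprB addrC subrK.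
  by rewrite -scalemxAl mulmxA.
have CCinf : C t @[t --> +oo] --> Cinf.
  pose a := n%:R * `|G|; pose b := `|C0 - Cinf|.
  have a0 : 0 <= a by rewrite mulr_ge0.
  have b0 : 0 <= b by exact: normr_ge0.
  apply/cvgrPdist_le => e e0; near=> t.
  have t0 : 0 <= t by near: t; exact/nbhs_pinfty_ge/num_real.
  (* With d = |C(t) - Cinf|, [subC] yields alpha t d <= a (b + d). Beyond this threshold the term a
     d is absorbed, leaving (a b / e + 1) d <= a b, hence d <= e. The summand 1 keeps the factor
     positive when a b = 0. *)
  have : (a + (a * b / e + 1)) / alpha <= t by near: t; exact/nbhs_pinfty_ge/num_real.
  rewrite ler_pdivrMr// [t * _]mulrC => alphat.
  have at0 : 0 <= alpha * t by rewrite mulr_ge0// ltW.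
  have le1 : alpha * t * `|C t - Cinf| <= a * (b + `|C t - Cinf|).
    rewrite -[X in X * _](ger0_norm at0) -normrZ subC//.
    rewrite (le_trans (ler_norm_mulmx _ _ _ _ _ _))// mulrAC ler_wpM2l//.
    by rewrite /b -[C0 - C t](subrKA Cinf) (le_trans (ler_normD _ _))// lerD2l distrC.
  have le2 : (a * b / e + 1) * `|C t - Cinf| <= (a * b / e + 1) * e.
    have -> : (a * b / e + 1) * e = a * b + e by field; rewrite gt_eqF.
    apply: (@le_trans _ _ (a * b)); last by rewrite lerDl ltW.
    have := normr_ge0 (C t - Cinf); nra.
  have q0 : 0 < a * b / e + 1 by rewrite ltr_wpDl// divr_ge0 ?mulr_ge0// ltW.
  by rewrite distrC -(ler_pM2l q0).
have CG t : 0 <= t -> alpha^-1 *: ((C0 - C t) *m G) = t *: (C t - Cinf).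
  by move=> t0; rewrite -subC// scalerA mulrA mulVf ?gt_eqF// mul1r.
split; first exact: cvgP CCinf.
rewrite (cvg_lim _ CCinf)//.
exists (alpha^-1 *: ((C0 - Cinf) *m G)); split.
  have H : alpha^-1 *: ((C0 - C t) *m G) @[t --> +oo] -->
      alpha^-1 *: ((C0 - Cinf) *m G).
    apply: cvgZr; apply: cvg_mulmx; last exact: cvg_cst.
    by apply: cvgB; first exact: cvg_cst.
  move: H; apply: cvg_trans; apply: near_eq_cvg.
  by near=> t; apply: CG; near: t; exact/nbhs_pinfty_ge/num_real.
have -> : C0 - Cinf = C0 *m (N *m G).
  by rewrite /Cinf mulmxBr mulmx1 opprB addrC subrK.
(* V is the group inverse of N, and the limit is alpha^-1 C0 V. As S C0 = N, the fixed-point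
   equation reduces to V N V = V. *)
pose V := N *m G *m G.
have VNG : V *m N *m G = V.
  by rewrite /V YN -[Y *m N *m G]mulmxA YN -!mulmxA [N *m (N *m G)]mulmxA -NG.
have VNV : V *m N *m V = V.
  by rewrite {2}/V !mulmxA -[V *m N *m N]mulmxA -[V *m (N *m N) *m G]mulmxA -NG.
have -> : C0 *m (N *m G) *m G = C0 *m V by rewrite /V !mulmxA.
have -> M : riccati_op alpha A Gamma M = alpha *: (M *m S *m M).
  by rewrite /riccati_op /S !mulmxA.
rewrite -!scalemxAl -!scalemxAr !scalerA mulfV ?gt_eqF// mul1r; congr (_ *: _).
by rewrite -[in RHS]VNV NE !mulmxA.
Unshelve. all: by end_near. Qed.
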